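(* Let $q\ge 1$ be an integer and let $f$ be an arithmetic function (defined on the positive integers, with complex values) that is periodic of period $q$ and has mean zero, i.e. $\sum_{n=1}^{q}f(n)=0$. For integers $k\ge 1$ let $F(k)=\sum_{1\le n\le k}f(n)$. Let $\Delta(x)=\sum_{n\ge 1}f(n)\{x/n\}$ for $x>0$. Then $$\Delta(x)\ll \frac{\sum_{k=1}^{q}|F(k)|}{q}\,\sqrt{x}\qquad\text{whenever } 1\le q\le x^{1/6}/22,$$ where the implied constant is absolute.
   Context: $\{t\}=t-\lfloor t\rfloor$ is the fractional part of $t$. The series defining $\Delta(x)$ is convergent (possibly only conditionally), summed in increasing order of $n$. Equivalently, if $g(n)=\sum_{d\mid n}f(d)$ and $C=\sum_{n\ge1}f(n)/n$, then $\Delta(x)=Cx-\sum_{n\le x}g(n)$. *)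

(* Defs.v *)
From Stdlib Require Import Reals.
From Coquelicot Require Import Coquelicot.

Local Open Scope R_scope.

(* Arithmetic functions are encoded as [f : nat -> C]; the value [f 0] is
   never used, and in particular is not constrained by periodicity. *)
Definition periodic (q : nat) (f : nat -> C) : Prop :=
  forall n : nat, (1 <= n)%nat -> f (n + q)%nat = f n.

Definition summatory (f : nat -> C) (k : nat) : C := sum_n_m f 1 k.

(* Coquelicot's series start at index 0, hence the shift: the term of index
   [n] is [f (n+1) {x / (n+1)}]. *)
Definition Delta_sum_term (f : nat -> C) (x : R) (n : nat) : C :=
  (f (S n) * RtoC (frac_part (x / INR (S n))))%C.

(* [Series] is total and real-valued, so the sum is taken componentwise; it is
   the actual sum as soon as [is_series (Delta_sum_term f x) (Delta_sum f x)]. *)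
Definition Delta_sum (f : nat -> C) (x : R) : C :=
  (Series (fun n => Re (Delta_sum_term f x n)),
   Series (fun n => Im (Delta_sum_term f x n))).

(* Main.v *)
(** Since [F q = 0], Abel summation gives [Delta(x) = sum F(n) ({x/n} - {x/(n+1)})].
    Terms with [n <= sqrt x] are bounded trivially.  For larger [n] the difference is
    [x/(n(n+1))] minus the jump of [floor(x/n)], and the jumps contribute
    [sum |F(floor(x/m))|] over [m <= sqrt x]; so it suffices that every residue class
    mod [q] contains [O(sqrt x / q)] of the integers [floor(x/m)], [m <= sqrt x].
    On a dyadic range of [m], cut into blocks of length [H] on which [x/m] is nearly
    linear, with slope [b] after division by [q].  If [u/v] is a Dirichlet approximation
    of [b] with [v <= H], the block contains [O(H/q + H/v)] solutions; the slopes of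
    successive blocks are well spaced, so few blocks have a small denominator [v].
    The resulting error [sqrt (q sqrt x)] is at most [sqrt x / q] exactly when
    [q <= x^(1/6)]. *)
Require Import Defs.
From Stdlib Require Import Reals Lra Lia ZArith List ClassicalEpsilon.
From Coquelicot Require Import Coquelicot.

Local Open Scope R_scope.

(** * Finite sums over an initial segment *)

Fixpoint sum_lt (n : nat) (f : nat -> R) : R :=
  match n with
  | O => 0
  | S n => sum_lt n f + f n
  end.

Lemma sum_lt_le n f g :
  (forall i, (i < n)%nat -> f i <= g i) -> sum_lt n f <= sum_lt n g.
Proof.
induction n as [|n IH]; intros H; simpl; [lra|].
apply Rplus_le_compat; [apply IH; intros; apply H; lia | apply H; lia].
Qed.

Lemma sum_lt_ext n f g :
  (forall i, (i < n)%nat -> f i = g i) -> sum_lt n f = sum_lt n g.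
Proof.
intros H; apply Rle_antisym; apply sum_lt_le; intros i Hi; rewrite (H i Hi); lra.
Qed.

Lemma sum_lt_const n c : sum_lt n (fun _ => c) = INR n * c.
Proof.
induction n as [|n IH]; [simpl; ring|].
rewrite S_INR; simpl; rewrite IH; ring.
Qed.

Lemma sum_lt_plus n f g :
  sum_lt n (fun i => f i + g i) = sum_lt n f + sum_lt n g.
Proof. induction n as [|n IH]; simpl; [ring | rewrite IH; ring]. Qed.

Lemma sum_lt_scal n c f : sum_lt n (fun i => c * f i) = c * sum_lt n f.
Proof. induction n as [|n IH]; simpl; [ring | rewrite IH; ring]. Qed.

Lemma sum_lt_ge0 n f : (forall i, (i < n)%nat -> 0 <= f i) -> 0 <= sum_lt n f.
Proof.
intros H; apply Rle_trans with (sum_lt n (fun _ => 0)).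
- rewrite sum_lt_const; lra.
- now apply sum_lt_le.
Qed.

Lemma sum_lt_swap n m (f : nat -> nat -> R) :
  sum_lt n (fun i => sum_lt m (f i)) = sum_lt m (fun j => sum_lt n (fun i => f i j)).
Proof.
induction n as [|n IH]; simpl.
- rewrite sum_lt_const; ring.
- now rewrite IH, <- sum_lt_plus.
Qed.

Lemma sum_lt_add n m f :
  sum_lt (n + m) f = sum_lt n f + sum_lt m (fun i => f (n + i)%nat).
Proof.
induction m as [|m IH].
- rewrite Nat.add_0_r; simpl; ring.
- rewrite Nat.add_succ_r; simpl; rewrite IH; ring.
Qed.

Lemma sum_lt_mul n m f :
  sum_lt (n * m) f = sum_lt n (fun i => sum_lt m (fun h => f (i * m + h)%nat)).
Proof.
induction n as [|n IH]; [reflexivity|].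
replace (S n * m)%nat with (n * m + m)%nat by lia.
rewrite sum_lt_add, IH; reflexivity.
Qed.

Lemma sum_lt_mono n m f :
  (n <= m)%nat -> (forall i, (i < m)%nat -> 0 <= f i) -> sum_lt n f <= sum_lt m f.
Proof.
intros Hnm H; replace m with (n + (m - n))%nat by lia.
rewrite sum_lt_add.
assert (0 <= sum_lt (m - n) (fun i => f (n + i)%nat)); [|lra].
apply sum_lt_ge0; intros i Hi; apply H; lia.
Qed.

Lemma sum_lt_term n f k :
  (k < n)%nat -> (forall i, (i < n)%nat -> 0 <= f i) -> f k <= sum_lt n f.
Proof.
intros Hk H.
apply Rle_trans with (sum_lt (S k) f).
- simpl; assert (0 <= sum_lt k f) by (apply sum_lt_ge0; intros; apply H; lia); lra.
- now apply sum_lt_mono.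
Qed.

(** * Indicators, spaced sequences, harmonic sums *)

Definition indic (P : Prop) : R := if excluded_middle_informative P then 1 else 0.

Lemma indic_true P : P -> indic P = 1.
Proof. intros H; unfold indic; destruct (excluded_middle_informative P); tauto. Qed.

Lemma indic_false P : ~ P -> indic P = 0.
Proof. intros H; unfold indic; destruct (excluded_middle_informative P); tauto. Qed.

Lemma indic_ge0 P : 0 <= indic P.
Proof. unfold indic; destruct (excluded_middle_informative P); lra. Qed.

Lemma indic_le1 P : indic P <= 1.
Proof. unfold indic; destruct (excluded_middle_informative P); lra. Qed.

Lemma indic_le (P Q : Prop) : (P -> Q) -> indic P <= indic Q.
Proof.
intros H; unfold indic.
destruct (excluded_middle_informative P), (excluded_middle_informative Q); try lra; tauto.
Qed.

(* Allowing [L < 0], where no [i] qualifies, makes the induction go through. *)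
Lemma count_spaced (g : nat -> R) (P : nat -> Prop) (a d : R) :
  0 < d ->
  (forall i j, (i < j)%nat -> P i -> P j -> g i + d <= g j) ->
  forall n L, - d <= L ->
  (forall i, (i < n)%nat -> P i -> a <= g i <= a + L) ->
  sum_lt n (fun i => indic (P i)) <= L / d + 1.
Proof.
intros Hd Hg n; induction n as [|n IH]; intros L HL Ha; simpl.
- assert (-1 <= L / d); [|lra].
  apply Rmult_le_reg_r with d; [lra|]; field_simplify; lra.
- destruct (classic (P n)) as [Pn|Pn].
  + rewrite (indic_true _ Pn).
    pose proof (Ha n (Nat.lt_succ_diag_r n) Pn) as [Hn1 Hn2].
    assert (H : sum_lt n (fun i => indic (P i)) <= (g n - d - a) / d + 1).
    { apply IH; [lra|]; intros i Hi Pi.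
      pose proof (Ha i ltac:(lia) Pi); pose proof (Hg i n Hi Pi Pn); lra. }
    replace ((g n - d - a) / d + 1) with ((g n - a) / d) in H by (field; lra).
    assert ((g n - a) / d <= L / d); [|lra].
    apply Rmult_le_compat_r; [left; now apply Rinv_0_lt_compat|lra].
  + rewrite (indic_false _ Pn), Rplus_0_r; apply IH; [lra|].
    intros i Hi; apply Ha; lia.
Qed.

(** Telescoping: with [b = sqrt (n + 1)] and [a = sqrt n], [2 (b - a) = 2 / (a + b) >= 1 / b >= 1 /
    b ^ 2]. This is cruder than a logarithm, but the range [q <= x^(1/6) / 22] absorbs it. *)
Lemma harmonic_le_sqrt n : sum_lt n (fun i => / INR (S i)) <= 2 * sqrt (INR n).
Proof.
induction n as [|n IH]; [simpl; rewrite sqrt_0; lra|].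
cbn [sum_lt].
assert (Hn : 0 <= INR n) by apply pos_INR.
rewrite S_INR.
set (a := sqrt (INR n)) in *; set (b := sqrt (INR n + 1)).
assert (Ha : a * a = INR n) by (apply sqrt_sqrt; lra).
assert (Hb : b * b = INR n + 1) by (apply sqrt_sqrt; lra).
assert (0 <= a) by apply sqrt_pos.
assert (Hb1 : 1 <= b) by (rewrite <- sqrt_1; apply sqrt_le_1; lra).
assert (a <= b) by (apply sqrt_le_1; lra).
rewrite <- Hb.
assert (/ (b * b) <= 2 * (b - a)); [|lra].
apply Rmult_le_reg_r with (b * b); [nra|].
rewrite Rinv_l by nra.
assert ((b - a) * (b + a) = 1) by nra.
nra.
Qed.

(** * Dirichlet approximation and linear sequences near integers *)

Lemma pigeonhole n (g : nat -> nat) :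
  (forall i, (i <= n)%nat -> (g i < n)%nat) ->
  exists i j, (i < j <= n)%nat /\ g i = g j.
Proof.
intros Hg; apply NNPP; intros Hno.
assert (Hinj : forall i j, (i <= n)%nat -> (j <= n)%nat -> g i = g j -> i = j).
{ intros i j Hi Hj E.
  destruct (Nat.lt_trichotomy i j) as [Hl|[He|Hl]]; [|exact He|]; exfalso; apply Hno.
  - exists i, j; split; [lia|exact E].
  - exists j, i; split; [lia|now symmetry]. }
assert (Hd : NoDup (map g (seq 0 (S n)))).
{ apply NoDup_map_NoDup_ForallPairs; [|apply seq_NoDup].
  intros i j Hi Hj; apply in_seq in Hi; apply in_seq in Hj; apply Hinj; lia. }
assert (Hi : incl (map g (seq 0 (S n))) (seq 0 n)).
{ intros y Hy; apply in_map_iff in Hy; destruct Hy as [i [<- Hi]].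
  apply in_seq in Hi; apply in_seq; specialize (Hg i); lia. }
pose proof (NoDup_incl_length Hd Hi) as Hl.
rewrite length_map, !length_seq in Hl; lia.
Qed.

(** The [H + 1] fractional parts of [i b], [0 <= i <= H], fall into [H] boxes of length [1 / H], so
    two of them share a box; their index difference is the denominator before reduction. *)
Lemma dirichlet_approx (b : R) (H : nat) :
  (1 <= H)%nat ->
  exists (v : nat) (u : Z), (1 <= v <= H)%nat /\ Z.gcd (Z.of_nat v) u = 1%Z /\
    Rabs (INR v * b - IZR u) < / INR H.
Proof.
intros HH.
assert (HR : 1 <= INR H) by (apply (le_INR 1); exact HH).
set (fr i := frac_part (INR i * b)).
assert (Hfr : forall i, 0 <= fr i < 1)
  by (intros i; destruct (base_fp (INR i * b)); unfold fr; lra).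
assert (Hfl : forall i, exists n : nat, INR n <= fr i * INR H < INR n + 1).
{ intros i; destruct (nfloor_ex (fr i * INR H)) as [n Hn].
  - specialize (Hfr i); nra.
  - now exists n. }
destruct (choice _ Hfl) as [g Hg].
destruct (pigeonhole H g) as [i [j [Hij E]]].
{ intros i _; apply INR_lt; specialize (Hg i); specialize (Hfr i); nra. }
set (w := (j - i)%nat).
set (z := (Int_part (INR j * b) - Int_part (INR i * b))%Z).
assert (Hw : Rabs (INR w * b - IZR z) < / INR H).
{ replace (INR w * b - IZR z) with (fr j - fr i).
  - pose proof (Hg i); pose proof (Hg j); rewrite E in *.
    apply Rmult_lt_reg_r with (INR H); [lra|]; rewrite Rinv_l by lra.
    rewrite <- (Rabs_pos_eq (INR H)) at 1 by lra; rewrite <- Rabs_mult.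
    apply Rabs_def1; lra.
  - unfold fr, frac_part, w, z; rewrite minus_INR, minus_IZR by lia; ring. }
(* Cancelling the gcd [d >= 1] yields a coprime pair and divides the error by [d]. *)
destruct (Z.gcd_divide_l (Z.of_nat w) z) as [v Hv].
destruct (Z.gcd_divide_r (Z.of_nat w) z) as [u Hu].
set (d := Z.gcd (Z.of_nat w) z) in *.
assert (Hd : (0 < d)%Z).
{ assert (0 <= d)%Z by apply Z.gcd_nonneg.
  assert (d <> 0%Z); [|lia].
  intros E0; rewrite E0 in Hv; unfold w in Hv; lia. }
assert (Hv0 : (0 < v)%Z) by (unfold w in Hv; nia).
exists (Z.to_nat v), u.
split; [|split].
- split; [lia|]; assert (v <= Z.of_nat w)%Z by nia; unfold w in *; lia.
- rewrite Z2Nat.id by lia.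
  assert (Hg1 : Z.gcd (v * d) (u * d) = d) by (rewrite <- Hv, <- Hu; reflexivity).
  rewrite Z.gcd_mul_mono_r, Z.abs_eq in Hg1 by lia.
  apply Z.mul_reg_r with d; lia.
- rewrite INR_IZR_INZ, Z2Nat.id by lia.
  rewrite INR_IZR_INZ, Hv, Hu, !mult_IZR in Hw.
  assert (Hd1 : 1 <= IZR d) by (apply IZR_le; lia).
  replace (IZR v * IZR d * b - IZR u * IZR d)
    with ((IZR v * b - IZR u) * IZR d) in Hw by ring.
  rewrite Rabs_mult, (Rabs_pos_eq (IZR d)) in Hw by lra.
  pose proof (Rabs_pos (IZR v * b - IZR u)); nra.
Qed.

(* With [t := u h + v j], membership in [[0, d]] confines the integer [t] to an
   interval of length [v d + 2], and [t] determines [h] modulo [v]. *)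
Lemma count_linear_near_integers (a b d : R) (H v : nat) (u : Z) :
  (1 <= v <= H)%nat -> Z.gcd (Z.of_nat v) u = 1%Z ->
  Rabs (INR v * b - IZR u) <= / INR H -> 0 <= d ->
  sum_lt H (fun h => indic (exists j : Z, 0 <= a + b * INR h + IZR j <= d))
    <= 2 * d * INR H + 8 * INR H / INR v.
Proof.
intros [Hv HvH] Hgcd Hu Hd.
assert (Hv1 : 1 <= INR v) by (apply (le_INR 1); exact Hv).
assert (HvH' : INR v <= INR H) by (apply le_INR; exact HvH).
(* Replacing [b] by [u / v] changes [v b h] by at most 1 for [h < H], so [t] lies in
   [[- v a - 1, v d - v a + 1]]. The [n] integers from [t0] on cover this interval. *)
destruct (archimed (- INR v * a - 2)) as [Ht1 Ht2].
set (t0 := up (- INR v * a - 2)) in *.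
destruct (nfloor_ex (INR v * d + 4)) as [n [Hn1 Hn2]]; [nra|].
apply Rle_trans with
  (sum_lt H (fun h => sum_lt n (fun i =>
     indic (exists j : Z, (u * Z.of_nat h + Z.of_nat v * j = t0 + Z.of_nat i)%Z)))).
{ apply sum_lt_le; intros h Hh.
  destruct (classic (exists j : Z, 0 <= a + b * INR h + IZR j <= d)) as [[j Hj]|Hno];
    [|rewrite (indic_false _ Hno); apply sum_lt_ge0; intros; apply indic_ge0].
  set (t := (u * Z.of_nat h + Z.of_nat v * j)%Z).
  assert (Ht : IZR t = INR v * (a + b * INR h + IZR j)
                       - (INR v * b - IZR u) * INR h - INR v * a).
  { unfold t; rewrite plus_IZR, !mult_IZR, <- !INR_IZR_INZ; ring. }
  assert (He : Rabs ((INR v * b - IZR u) * INR h) <= 1).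
  { rewrite Rabs_mult, (Rabs_pos_eq (INR h)) by apply pos_INR.
    assert (INR h <= INR H) by (apply le_INR; lia).
    apply Rle_trans with (/ INR H * INR H); [|right; field; lra].
    apply Rmult_le_compat; auto using Rabs_pos, pos_INR. }
  apply Rabs_le_between in He.
  assert (Hvd : 0 <= INR v * (a + b * INR h + IZR j) <= INR v * d) by nra.
  assert (Hlo : (t0 <= t)%Z) by (apply le_IZR; lra).
  assert (Hhi : (t < t0 + Z.of_nat n)%Z)
    by (apply lt_IZR; rewrite plus_IZR, <- INR_IZR_INZ; lra).
  apply Rle_trans with (indic (exists j : Z,
    (u * Z.of_nat h + Z.of_nat v * j = t0 + Z.of_nat (Z.to_nat (t - t0)))%Z)).
  - apply indic_le; intros _; exists j; fold t; lia.
  - apply (sum_lt_term n (fun i => indic (exists j : Z,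
      (u * Z.of_nat h + Z.of_nat v * j = t0 + Z.of_nat i)%Z))); [lia|].
    intros; apply indic_ge0. }
rewrite sum_lt_swap.
apply Rle_trans with (sum_lt n (fun _ => INR H / INR v + 1)).
{ apply sum_lt_le; intros i Hi.
  apply (count_spaced INR _ 0 (INR v)); [lra| |lra|].
  - intros h h' Hh [j Hj] [j' Hj'].
    assert (Hdiv : (Z.of_nat v | Z.of_nat h' - Z.of_nat h)%Z).
    { apply Z.gauss with u; [exists (j - j')%Z; lia|exact Hgcd]. }
    apply Z.divide_pos_le in Hdiv; [|lia].
    rewrite <- plus_INR; apply le_INR; lia.
  - intros h Hh _; assert (INR h <= INR H) by (apply le_INR; lia).
    pose proof (pos_INR h); lra. }
rewrite sum_lt_const.
(* As [v <= H], the count [H / v + 1] for each [t] is at most [2 H / v]; times [v d + 4] this gives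
   the constants 2 and 8. *)
assert (1 <= INR H / INR v)
  by (apply Rmult_le_reg_r with (INR v); [lra|]; field_simplify; lra).
apply Rle_trans with ((INR v * d + 4) * (2 * (INR H / INR v))).
- apply Rmult_le_compat; try lra; apply pos_INR.
- right; field; lra.
Qed.

(** * Counting along the hyperbola *)

(* For integral [r] and [Q]: [floor (x / m)] is congruent to [r] modulo [Q]. *)
Definition hit (x Q r : R) (m : nat) : Prop :=
  exists j : Z, r + IZR j * Q <= x / INR m < r + IZR j * Q + 1.

(* On a block starting at [m0] the curve [x / m] stays within [W] of its tangent at [m0]. *)
Lemma count_block (x Q r W : R) (m0 H v : nat) (u : Z) :
  0 < x -> 0 < Q -> (1 <= m0)%nat -> x * INR H ^ 2 / INR m0 ^ 3 <= W ->
  (1 <= v <= H)%nat -> Z.gcd (Z.of_nat v) u = 1%Z ->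
  Rabs (INR v * (x / (Q * INR m0 ^ 2)) - IZR u) <= / INR H ->
  sum_lt H (fun h => indic (hit x Q r (m0 + h)))
    <= 2 * ((1 + W) / Q) * INR H + 8 * INR H / INR v.
Proof.
intros Hx HQ Hm HW Hv Hg Hu.
assert (Hm1 : 1 <= INR m0) by (apply (le_INR 1); exact Hm).
assert (HW0 : 0 <= W).
{ apply Rle_trans with (2 := HW); apply Rmult_le_pos.
  - apply Rmult_le_pos; [lra|apply pow2_ge_0].
  - left; apply Rinv_0_lt_compat, pow_lt; lra. }
(* The sign is reversed to make the slope positive. The window of width 1 in [hit] and the deviation
   [E] from the tangent, [0 <= E <= W], add up to the width [(1 + W) / Q]. *)
apply Rle_trans with (sum_lt H (fun h => indic (exists j : Z,
  0 <= (r + 1 - x / INR m0) / Q + x / (Q * INR m0 ^ 2) * INR h + IZR j <= (1 + W) / Q))).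
2:{ apply count_linear_near_integers with u; auto.
    apply Rmult_le_pos; [lra|left; now apply Rinv_0_lt_compat]. }
apply sum_lt_le; intros h Hh; apply indic_le; intros [j Hj]; exists j.
rewrite plus_INR in Hj.
assert (Hh0 : 0 <= INR h) by apply pos_INR.
assert (HhH : INR h <= INR H) by (apply le_INR; lia).
set (m := INR m0) in *; set (k := INR h) in *.
set (E := x * k ^ 2 / (m ^ 2 * (m + k))).
assert (HE : x / (m + k) = x / m - x / m ^ 2 * k + E) by (unfold E; field; lra).
assert (HE0 : 0 <= E).
{ unfold E; apply Rmult_le_pos; [nra|].
  left; apply Rinv_0_lt_compat; apply Rmult_lt_0_compat; [nra|lra]. }
assert (HEW : E <= W).
{ apply Rle_trans with (2 := HW); unfold E.
  apply Rmult_le_compat; [nra| | |].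
  - left; apply Rinv_0_lt_compat; apply Rmult_lt_0_compat; [nra|lra].
  - apply Rmult_le_compat_l; [lra|]; apply pow_incr; lra.
  - apply Rinv_le_contravar; [apply pow_lt; lra|].
    replace (m ^ 3) with (m ^ 2 * m) by ring.
    apply Rmult_le_compat_l; [apply pow2_ge_0|lra]. }
replace ((r + 1 - x / m) / Q + x / (Q * m ^ 2) * k + IZR j)
  with ((r + IZR j * Q + 1 - (x / m - x / m ^ 2 * k)) / Q) by (field; lra).
assert (HiQ : 0 < / Q) by now apply Rinv_0_lt_compat.
split.
- apply Rmult_le_pos; lra.
- apply Rmult_le_compat_r; lra.
Qed.

(** On [[M, 2 M]] the derivative of [1 / y ^ 2] has size at least [2 / (8 M ^ 3)]. This separates
    the slopes of successive blocks. *)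
Lemma inv_sqr_gap (y z h M : R) :
  0 < M -> 0 <= h -> M <= y -> y + h <= z -> z <= 2 * M ->
  h / (4 * M ^ 3) <= / y ^ 2 - / z ^ 2.
Proof.
intros HM Hh Hy Hz Hz2.
assert (0 < y) by lra; assert (0 < z) by lra.
replace (/ y ^ 2 - / z ^ 2) with ((z - y) * (/ (y * z ^ 2) + / (y ^ 2 * z))) by (field; lra).
replace (h / (4 * M ^ 3)) with (h * (/ (8 * M ^ 3) + / (8 * M ^ 3))) by (field; lra).
assert (0 < y * z ^ 2) by (apply Rmult_lt_0_compat; [lra|now apply pow_lt]).
assert (0 < y ^ 2 * z) by (apply Rmult_lt_0_compat; [now apply pow_lt|lra]).
assert (Hyz : y * z <= (2 * M) * (2 * M)) by (apply Rmult_le_compat; lra).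
assert (y * z ^ 2 <= 8 * M ^ 3).
{ replace (y * z ^ 2) with (y * z * z) by ring.
  replace (8 * M ^ 3) with ((2 * M) * (2 * M) * (2 * M)) by ring.
  apply Rmult_le_compat; nra. }
assert (y ^ 2 * z <= 8 * M ^ 3).
{ replace (y ^ 2 * z) with (y * z * y) by ring.
  replace (8 * M ^ 3) with ((2 * M) * (2 * M) * (2 * M)) by ring.
  apply Rmult_le_compat; nra. }
assert (0 < / (8 * M ^ 3)) by (apply Rinv_0_lt_compat; lra).
apply Rmult_le_compat; [lra|lra|lra|].
apply Rplus_le_compat; apply Rinv_le_contravar; assumption.
Qed.

(* The numerator [u] is positive because the slopes exceed [1 / H]. *)
Lemma count_slopes_near_rational (x Q W : R) (M H I v : nat) :
  0 < x -> 0 < Q -> (2 <= H)%nat -> (1 <= M)%nat -> (1 <= v)%nat ->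
  W = x * INR H ^ 2 / INR M ^ 3 ->
  INR v <= Q / W ->
  4 * Q * INR M ^ 2 <= x * INR H ->
  (forall i, (i < I)%nat -> (i * H <= M)%nat) ->
  sum_lt I (fun i => indic (exists u : Z,
      Rabs (INR v * (x / (Q * INR (M + i * H) ^ 2)) - IZR u) < / INR H))
    <= 18 * x / (INR M ^ 2 * W).
Proof.
intros Hx HQ HH HM Hv HW HvW Hmin HI.
assert (HM1 : 1 <= INR M) by (apply (le_INR 1); exact HM).
assert (HH2 : 2 <= INR H) by (apply (le_INR 2); exact HH).
assert (Hv1 : 1 <= INR v) by (apply (le_INR 1); exact Hv).
assert (HM3 : 0 < INR M ^ 3) by (apply pow_lt; lra).
assert (HM2 : 0 < INR M ^ 2) by (apply pow_lt; lra).
assert (HH22 : 0 < INR H ^ 2) by (apply pow_lt; lra).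
assert (HW0 : 0 < W).
{ rewrite HW; apply Rmult_lt_0_compat; [nra|now apply Rinv_0_lt_compat]. }
set (b i := x / (Q * INR (M + i * H) ^ 2)).
set (b0 := x / (Q * INR M ^ 2)).
assert (HQM : 0 < Q * INR M ^ 2) by (apply Rmult_lt_0_compat; lra).
assert (Hb0 : 0 < b0)
  by (apply Rmult_lt_0_compat; [lra|apply Rinv_0_lt_compat; nra]).
assert (HMi : forall i, (i < I)%nat -> INR M <= INR (M + i * H) <= 2 * INR M).
{ intros i Hi; specialize (HI i Hi).
  replace (2 * INR M) with (INR (M + M)) by (rewrite plus_INR; ring).
  split; apply le_INR; lia. }
assert (Hb : forall i, (i < I)%nat -> / INR H <= b i <= b0).
{ intros i Hi; specialize (HMi i Hi); set (y := INR (M + i * H)) in *.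
  assert (INR M ^ 2 <= y ^ 2 <= 4 * INR M ^ 2).
  { replace (4 * INR M ^ 2) with ((2 * INR M) ^ 2) by ring.
    split; apply pow_incr; lra. }
  unfold b, b0; fold y; split.
  - apply Rle_trans with (x / (4 * Q * INR M ^ 2)).
    + apply Rmult_le_reg_r with (INR H * (4 * Q * INR M ^ 2));
        [apply Rmult_lt_0_compat; lra|].
      replace (/ INR H * (INR H * (4 * Q * INR M ^ 2)))
        with (4 * Q * INR M ^ 2) by (field; lra).
      replace (x / (4 * Q * INR M ^ 2) * (INR H * (4 * Q * INR M ^ 2)))
        with (x * INR H) by (field; lra).
      exact Hmin.
    + apply Rmult_le_compat_l; [lra|]; apply Rinv_le_contravar; [|nra].
      apply Rmult_lt_0_compat; lra.
  - apply Rmult_le_compat_l; [lra|]; apply Rinv_le_contravar; [lra|nra]. }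
assert (HiH : / INR H <= / 2) by (apply Rinv_le_contravar; lra).
assert (HiH0 : 0 < / INR H) by (apply Rinv_0_lt_compat; lra).
(* Every admissible numerator satisfies [0 < u < v b0 + 1 / H], and [H >= 2], so [u] runs through
   [1, ..., U]. *)
destruct (nfloor_ex (INR v * b0 + / 2)) as [U [HU1 HU2]]; [nra|].
(* The condition [i < I] goes inside the indicator because [count_spaced] asks for spacing at all
   indices, while the slopes are controlled only for [i < I]. *)
apply Rle_trans with (sum_lt I (fun i => sum_lt U (fun k => indic ((i < I)%nat /\
   Rabs (INR v * b i - IZR (Z.of_nat (S k))) < / INR H)))).
{ apply sum_lt_le; intros i Hi; fold (b i).
  destruct (classic (exists u : Z, Rabs (INR v * b i - IZR u) < / INR H)) as [[u Hu]|Hno];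
    [|rewrite (indic_false _ Hno); apply sum_lt_ge0; intros; apply indic_ge0].
  pose proof (Hb i Hi) as [Hb1 Hb2].
  pose proof (Rabs_def2 _ _ Hu) as [Hu1 Hu2].
  assert (Hu0 : (0 < u)%Z) by (apply lt_IZR; nra).
  assert (HuU : (u < Z.of_nat U + 1)%Z).
  { apply lt_IZR; rewrite plus_IZR, <- INR_IZR_INZ; nra. }
  apply Rle_trans with (indic ((i < I)%nat /\
    Rabs (INR v * b i - IZR (Z.of_nat (S (Z.to_nat (u - 1))))) < / INR H)).
  - apply indic_le; intros _; split; [exact Hi|].
    replace (Z.of_nat (S (Z.to_nat (u - 1)))) with u by lia; exact Hu.
  - apply (sum_lt_term U (fun k => indic ((i < I)%nat /\
      Rabs (INR v * b i - IZR (Z.of_nat (S k))) < / INR H))); [lia|].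
    intros; apply indic_ge0. }
rewrite sum_lt_swap.
set (d := W / (4 * Q * INR H)).
assert (Hd : 0 < d)
  by (apply Rmult_lt_0_compat; [lra|apply Rinv_0_lt_compat; nra]).
(* For one numerator the slopes lie in an interval of length [2 / (v H)] and are [d] apart: at most
   [8 Q / (v W) + 1] of them, and [1 <= Q / (v W)] by the bound on [v]. *)
apply Rle_trans with (sum_lt U (fun _ => 9 * Q / (INR v * W))).
{ apply sum_lt_le; intros k _.
  set (c := IZR (Z.of_nat (S k))).
  apply Rle_trans with (2 / (INR v * INR H) / d + 1).
  - assert (Hvi : 0 < / INR v) by (apply Rinv_0_lt_compat; lra).
    (* The slopes decrease with [i], hence the minus sign. *)
    apply (count_spaced (fun i => - b i) _ (- (c / INR v) - / (INR v * INR H)) d Hd).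
    + intros i j Hij [Hi _] [Hj _].
      pose proof (inv_sqr_gap (INR (M + i * H)) (INR (M + j * H)) (INR H) (INR M)
        ltac:(lra) ltac:(lra) ltac:(apply HMi; exact Hi)
        ltac:(rewrite <- plus_INR; apply le_INR; nia) ltac:(apply HMi; exact Hj)) as Hgap.
      apply Rmult_le_compat_l with (r := x / Q) in Hgap;
        [|apply Rmult_le_pos; [lra|left; now apply Rinv_0_lt_compat]].
      assert (Hy1 := HMi i Hi); assert (Hy2 := HMi j Hj).
      unfold b, d; rewrite HW.
      replace (x * INR H ^ 2 / INR M ^ 3 / (4 * Q * INR H))
        with (x / Q * (INR H / (4 * INR M ^ 3))) by (field; lra).
      replace (x / (Q * INR (M + i * H) ^ 2))
        with (x / Q * / INR (M + i * H) ^ 2) by (field; lra).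
      replace (x / (Q * INR (M + j * H) ^ 2))
        with (x / Q * / INR (M + j * H) ^ 2) by (field; lra).
      lra.
    + assert (0 <= 2 / (INR v * INR H)); [|lra].
      apply Rmult_le_pos; [lra|left; apply Rinv_0_lt_compat; nra].
    + intros i _ [Hi Hr]; apply Rabs_def2 in Hr; destruct Hr as [Hr1 Hr2].
      assert (He : / (INR v * INR H) = / INR v * / INR H) by (field; lra).
      replace (b i) with (c / INR v + / INR v * (INR v * b i - c)) by (field; lra).
      unfold Rdiv at 4; rewrite He.
      set (e := INR v * b i - c) in *; fold c in Hr1, Hr2; fold e in Hr1, Hr2.
      nra.
  - replace (2 / (INR v * INR H) / d) with (8 * Q / (INR v * W))
      by (unfold d; field; lra).
    assert (1 <= Q / (INR v * W)); [|unfold Rdiv in *; lra].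
    replace (Q / (INR v * W)) with (Q / W * / INR v) by (field; lra).
    apply Rmult_le_reg_r with (INR v); [lra|].
    rewrite Rmult_assoc, Rinv_l; lra. }
rewrite sum_lt_const.
(* If [U >= 1] then [v b0 >= 1 / 2], so [U <= 2 v b0]. *)
apply Rle_trans with (2 * (INR v * b0) * (9 * Q / (INR v * W))).
- apply Rmult_le_compat_r.
  + apply Rmult_le_pos; [lra|left; apply Rinv_0_lt_compat; nra].
  + destruct (Nat.eq_dec U 0) as [->|HU]; [simpl; nra|].
    assert (1 <= INR U) by (apply (le_INR 1); lia); lra.
- right; unfold b0; field; lra.
Qed.

(** Each block costs [O(H W / Q + H / v)] with [v] its Dirichlet denominator. If [v > Q / W], the
    second term is absorbed by the first; otherwise the block is charged to [v], and summing the
    bound of [count_slopes_near_rational] against [1 / v] gives the second main term. *)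
Lemma count_dyadic (x Q r W : R) (M H : nat) :
  0 < x -> 0 < Q -> (2 <= H <= M)%nat ->
  W = x * INR H ^ 2 / INR M ^ 3 -> 1 <= W ->
  4 * Q * INR M ^ 2 <= x * INR H ->
  sum_lt M (fun h => indic (hit x Q r (M + h)))
    <= 24 * INR M * W / Q + 288 * INR H * x / (INR M ^ 2 * W) * sqrt (Q / W).
Proof.
intros Hx HQ [HH HHM] HW HW1 Hmin.
assert (HM2 : 2 <= INR M) by (apply (le_INR 2); lia).
assert (HH2 : 2 <= INR H) by (apply (le_INR 2); exact HH).
assert (HHM' : INR H <= INR M) by (apply le_INR; exact HHM).
assert (HQW : 0 < Q / W) by (apply Rmult_lt_0_compat; [lra|apply Rinv_0_lt_compat; lra]).
assert (HWQ : 0 < W / Q) by (apply Rmult_lt_0_compat; [lra|now apply Rinv_0_lt_compat]).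
(* The number of blocks is rounded up: they cover the whole range, may overshoot it, and have total
   length at most [2 M]. *)
set (I := S (M / H)).
assert (HI : forall i, (i < I)%nat -> (i * H <= M)%nat).
{ intros i Hi; pose proof (Nat.div_mod_eq M H); unfold I in Hi; nia. }
assert (HIM : (M <= I * H)%nat).
{ pose proof (Nat.div_mod_eq M H); pose proof (Nat.mod_upper_bound M H); unfold I; nia. }
assert (HI2 : INR I * INR H <= 2 * INR M).
{ unfold I; rewrite S_INR.
  assert (INR (M / H) * INR H <= INR M); [|lra].
  rewrite <- mult_INR; apply le_INR; rewrite Nat.mul_comm; apply Nat.Div0.mul_div_le. }
destruct (nfloor_ex (Q / W)) as [V [HV1 HV2]]; [lra|].
set (D i v := exists u : Z,
  Rabs (INR v * (x / (Q * INR (M + i * H) ^ 2)) - IZR u) < / INR H).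
(* [T i] collects [1 / v] over all small [v] that approximate the slope of block [i], so it
   dominates the contribution of the chosen denominator and can be summed over [i] first. *)
set (T i := sum_lt V (fun k => / INR (S k) * indic (D i (S k)))).
assert (HSk : forall k, 0 < / INR (S k))
  by (intros; apply Rinv_0_lt_compat, (lt_INR 0); lia).
assert (HT0 : forall i, 0 <= T i).
{ intros i; apply sum_lt_ge0; intros k _; apply Rmult_le_pos;
    [left; apply HSk|apply indic_ge0]. }
apply Rle_trans with
  (sum_lt I (fun i => sum_lt H (fun h => indic (hit x Q r (M + (i * H + h)))))).
{ rewrite <- (sum_lt_mul I H (fun k => indic (hit x Q r (M + k)))).
  apply sum_lt_mono; [exact HIM|intros; apply indic_ge0]. }
apply Rle_trans with
  (sum_lt I (fun i => 12 * (W / Q) * INR H + 8 * INR H * T i)).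
{ apply sum_lt_le; intros i Hi.
  destruct (dirichlet_approx (x / (Q * INR (M + i * H) ^ 2)) H) as [v [u [Hv [Hg Hu]]]];
    [lia|].
  assert (Hv1 : 1 <= INR v) by (apply (le_INR 1); lia).
  assert (Hiv : / INR v <= W / Q + T i).
  { destruct (le_lt_dec v V) as [HvV|HVv].
    - assert (/ INR v <= T i); [|lra].
      apply Rle_trans with (/ INR (S (v - 1)) * indic (D i (S (v - 1)))).
      + replace (S (v - 1)) with v by lia.
        rewrite indic_true by (exists u; exact Hu); lra.
      + apply (sum_lt_term V (fun k => / INR (S k) * indic (D i (S k)))); [lia|].
        intros k _; apply Rmult_le_pos; [left; apply HSk|apply indic_ge0].
    - assert (/ INR v <= W / Q); [|specialize (HT0 i); lra].
      replace (W / Q) with (/ (Q / W)) by (field; lra).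
      apply Rinv_le_contravar; [lra|].
      apply le_INR in HVv; rewrite S_INR in HVv; lra. }
  rewrite (sum_lt_ext _ _ (fun h => indic (hit x Q r ((M + i * H) + h))))
    by (intros; now rewrite Nat.add_assoc).
  apply Rle_trans with (2 * ((1 + W) / Q) * INR H + 8 * INR H / INR v).
  - apply count_block with u; try assumption; try lia; [|now left].
    rewrite HW; apply Rmult_le_compat_l; [apply Rmult_le_pos; [lra|apply pow2_ge_0]|].
    apply Rinv_le_contravar; [apply pow_lt; lra|].
    apply pow_incr; split; [lra|apply le_INR; lia].
  - assert (H1 : (1 + W) / Q <= 2 * (W / Q)).
    { unfold Rdiv; rewrite <- Rmult_assoc; apply Rmult_le_compat_r;
        [left; now apply Rinv_0_lt_compat|lra]. }
    unfold Rdiv at 2.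
    assert (8 * INR H * / INR v <= 8 * INR H * (W / Q + T i))
      by (apply Rmult_le_compat_l; lra).
    nra. }
rewrite sum_lt_plus, sum_lt_const, sum_lt_scal.
set (B := 18 * x / (INR M ^ 2 * W)).
assert (HM22 : 0 < INR M ^ 2) by (apply pow_lt; lra).
assert (HB0 : 0 < B) by (apply Rmult_lt_0_compat; [lra|apply Rinv_0_lt_compat; nra]).
assert (HT : sum_lt I T <= B * (2 * sqrt (Q / W))).
{ unfold T; rewrite sum_lt_swap.
  apply Rle_trans with (sum_lt V (fun k => B * / INR (S k))).
  - apply sum_lt_le; intros k Hk; rewrite sum_lt_scal, Rmult_comm.
    apply Rmult_le_compat_r; [left; apply HSk|].
    apply count_slopes_near_rational; auto; try lia.
    apply Rle_trans with (INR V); [apply le_INR; lia|exact HV1].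
  - rewrite sum_lt_scal; apply Rmult_le_compat_l; [lra|].
    apply Rle_trans with (1 := harmonic_le_sqrt V).
    apply Rmult_le_compat_l; [lra|].
    apply sqrt_le_1; [apply pos_INR|lra|exact HV1]. }
replace (288 * INR H * x / (INR M ^ 2 * W) * sqrt (Q / W))
  with (8 * INR H * (B * (2 * sqrt (Q / W)))) by (unfold B; field; lra).
apply Rplus_le_compat.
- replace (24 * INR M * W / Q) with (2 * INR M * (12 * (W / Q))) by (field; lra).
  replace (INR I * (12 * (W / Q) * INR H)) with (INR I * INR H * (12 * (W / Q))) by ring.
  apply Rmult_le_compat_r; lra.
- apply Rmult_le_compat_l; lra.
Qed.

(* Writing [M = s / t ^ 8], the block length [H ~ sqrt s / t ^ 9] gives [W ~ t ^ 6]: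
   the bound then decays geometrically along dyadic ranges. *)
Lemma count_dyadic_decay (s Q r t : R) (M : nat) :
  1 <= Q -> (22 * Q) ^ 3 <= s -> 1 <= t -> INR M * t ^ 8 = s -> t ^ 8 <= 2 * Q ->
  sum_lt M (fun h => indic (hit (s ^ 2) Q r (M + h))) <= 672 * (s / (Q * t ^ 2)).
Proof.
intros HQ Hs Ht HM Ht8.
assert (HQ3 : 1 <= Q ^ 3) by (apply pow_R1_Rle; exact HQ).
replace ((22 * Q) ^ 3) with (10648 * Q ^ 3) in Hs by ring.
set (w := sqrt s).
assert (Hw2 : w ^ 2 = s) by (apply pow2_sqrt; lra).
assert (Hw0 : 0 < w) by (apply sqrt_lt_R0; lra).
assert (Htp : forall n, 1 <= t ^ n) by (intros; now apply pow_R1_Rle).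
assert (Htp0 : forall n, 0 < t ^ n) by (intros; apply pow_lt; lra).
set (h0 := w / t ^ 9).
(* Here [h0 ^ 2 = s / t ^ 18] with [t ^ 18 <= t ^ 24 <= 8 Q ^ 3] and [s >= 22 ^ 3 Q ^ 3], so
   [h0 ^ 2 >= 11 ^ 3 > 36 ^ 2]. *)
assert (Hh0 : 36 <= h0).
{ apply Rsqr_incr_0_var.
  2:{ apply Rmult_le_pos; [lra|left; apply Rinv_0_lt_compat, Htp0]. }
  unfold Rsqr, h0.
  replace (w / t ^ 9 * (w / t ^ 9)) with (w ^ 2 / t ^ 18)
    by (field; lra).
  rewrite Hw2; apply Rmult_le_reg_r with (t ^ 18); [apply Htp0|].
  replace (s / t ^ 18 * t ^ 18) with s by (field; lra).
  assert (t ^ 18 <= t ^ 24) by (apply Rle_pow; [lra|lia]).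
  assert (t ^ 24 <= 8 * Q ^ 3); [|lra].
  replace (t ^ 24) with ((t ^ 8) ^ 3) by ring.
  replace (8 * Q ^ 3) with ((2 * Q) ^ 3) by ring.
  apply pow_incr; split; [specialize (Htp0 8%nat); lra|exact Ht8]. }
assert (Hwt : h0 * t ^ 9 = w) by (unfold h0; field; lra).
assert (Hw36 : 36 <= w) by (specialize (Htp 9%nat); nra).
destruct (nfloor_ex h0) as [H' [HH1 HH2]]; [lra|].
set (H := S H').
assert (HH : h0 <= INR H <= 2 * h0) by (unfold H; rewrite S_INR; lra).
(* [e] records the effect of rounding [h0] up to an integer; with it [W = e ^ 2 * t ^ 6] holds
   exactly. *)
set (e := INR H / h0).
assert (He : 1 <= e <= 2).
{ unfold e; split; apply Rmult_le_reg_r with h0; try lra;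
  unfold Rdiv; rewrite Rmult_assoc, Rinv_l; lra. }
assert (HHe : INR H = e * (w / t ^ 9)) by (unfold e; fold h0; field; lra).
assert (HMe : INR M = w ^ 2 / t ^ 8).
{ rewrite Hw2, <- HM; field; lra. }
assert (HQw : Q ^ 3 <= w ^ 2) by lra.
set (W := e ^ 2 * t ^ 6).
assert (He2 : 1 <= e ^ 2 <= 4) by (split; nra).
assert (HW6 : t ^ 6 <= W) by (unfold W; specialize (Htp0 6%nat); nra).
apply Rle_trans with (24 * INR M * W / Q
  + 288 * INR H * s ^ 2 / (INR M ^ 2 * W) * sqrt (Q / W)).
{ apply count_dyadic with (H := H); [nra|lra| | | |].
  - split; [apply INR_le; simpl (INR 2); lra|].
    apply INR_le; apply Rle_trans with (2 * h0); [lra|].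
    rewrite HMe; unfold h0; replace (w ^ 2 / t ^ 8) with (w * t * (w / t ^ 9)) by (field; lra).
    apply Rmult_le_compat_r; [fold h0; lra|nra].
  - rewrite HHe, HMe, <- Hw2; unfold W; field; lra.
  - specialize (Htp 6%nat); lra.
  - rewrite HHe, HMe, <- Hw2.
    replace (4 * Q * (w ^ 2 / t ^ 8) ^ 2) with (4 * Q * (w ^ 4 / t ^ 16)) by (field; lra).
    replace ((w ^ 2) ^ 2 * (e * (w / t ^ 9))) with (e * w * t ^ 7 * (w ^ 4 / t ^ 16))
      by (field; lra).
    apply Rmult_le_compat_r.
    + apply Rmult_le_pos; [apply pow_le; lra|left; apply Rinv_0_lt_compat, Htp0].
    + assert (4 * Q <= w).
      { apply Rsqr_incr_0_var; [|lra]; unfold Rsqr.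
        replace (w * w) with (w ^ 2) by ring; rewrite Hw2.
        replace (Q ^ 3) with (Q * Q * Q) in Hs by ring.
        assert (Q * Q * 1 <= Q * Q * Q) by (apply Rmult_le_compat_l; nra). nra. }
      assert (1 <= e * t ^ 7) by (specialize (Htp 7%nat); nra).
      nra. }
(* This is where the size of [Q] is decisive: after squaring and using [W >= t ^ 6], the inequality
   becomes [Q ^ 3 <= w ^ 2 = s]. *)
assert (Hsq : sqrt (Q / W) <= w / (Q * t ^ 3)).
{ rewrite <- (sqrt_pow2 (w / (Q * t ^ 3))).
  2:{ apply Rmult_le_pos; [lra|left; apply Rinv_0_lt_compat].
      specialize (Htp0 3%nat); nra. }
  assert (HQt : 0 < Q / t ^ 6)
    by (apply Rmult_lt_0_compat; [lra|apply Rinv_0_lt_compat, Htp0]).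
  assert (HQWt : Q / W <= Q / t ^ 6)
    by (apply Rmult_le_compat_l; [lra|now apply Rinv_le_contravar]).
  apply sqrt_le_1.
  - apply Rmult_le_pos; [lra|left; apply Rinv_0_lt_compat].
    specialize (Htp0 6%nat); lra.
  - apply pow2_ge_0.
  - apply Rle_trans with (1 := HQWt).
    replace (Q / t ^ 6) with (Q ^ 3 * / (Q ^ 2 * t ^ 6)) by (field; lra).
    replace ((w / (Q * t ^ 3)) ^ 2) with (w ^ 2 * / (Q ^ 2 * t ^ 6)) by (field; lra).
    apply Rmult_le_compat_r; [|exact HQw].
    left; apply Rinv_0_lt_compat, Rmult_lt_0_compat; [apply pow_lt; lra|apply Htp0]. }
set (y := s / (Q * t ^ 2)).
assert (Hy : 0 < y).
{ apply Rmult_lt_0_compat; [lra|apply Rinv_0_lt_compat].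
  apply Rmult_lt_0_compat; [lra|apply Htp0]. }
replace (24 * INR M * W / Q) with (24 * (e ^ 2 * y))
  by (rewrite HMe, Hw2; unfold W, y; field; lra).
apply Rle_trans with (24 * (4 * y) + 288 * (/ e * y)).
2:{ assert (/ e <= 1) by (rewrite <- Rinv_1; apply Rinv_le_contravar; lra). nra. }
apply Rplus_le_compat; [nra|].
replace (288 * INR H * s ^ 2 / (INR M ^ 2 * W)) with (288 * (/ e * (w * t)))
  by (rewrite HHe, HMe, <- Hw2; unfold W; field; lra).
replace (288 * (/ e * y)) with (288 * (/ e * (w * t)) * (w / (Q * t ^ 3)))
  by (unfold y; rewrite <- Hw2; field; lra).
apply Rmult_le_compat_l; [|exact Hsq].
assert (0 < / e) by (apply Rinv_0_lt_compat; lra).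
assert (0 < w * t) by nra.
nra.
Qed.

(** Strong induction by halving [M]. The upper half costs [672 p] with [p = (M / s)^(1/4)], and
    halving multiplies [p] by at most [6 / 7], because [(6 / 7) ^ 4 > 1 / 2]. The constant solves
    [4704 * 6 / 7 + 672 = 4704]. *)
Lemma count_hits_decay (s Q r : R) (M : nat) :
  1 <= Q -> (22 * Q) ^ 3 <= s -> INR M <= s ->
  sum_lt M (fun h => indic (hit (s ^ 2) Q r (S h)))
    <= s / Q * (1 + 4704 * sqrt (sqrt (INR M / s))).
Proof.
intros HQ Hs; induction M as [M IH] using lt_wf_ind; intros HMs.
assert (HsQ : 2 * Q <= s).
{ replace ((22 * Q) ^ 3) with (10648 * (Q * Q * Q)) in Hs by ring.
  assert (1 <= Q * Q) by nra; nra. }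
assert (HsQ0 : 2 <= s / Q).
{ apply Rmult_le_reg_r with Q; [lra|].
  unfold Rdiv; rewrite Rmult_assoc, Rinv_l; lra. }
set (p := sqrt (sqrt (INR M / s))).
assert (Hp : 0 <= p) by apply sqrt_pos.
(* Below [s / Q] the trivial count gives the term 1. Above it, [M > s / Q] ensures [t ^ 8 <= 2 Q]
   for the dyadic bound. *)
destruct (Rle_lt_dec (INR M) (s / Q)) as [Hle|Hlt].
{ apply Rle_trans with (sum_lt M (fun _ => 1)).
  - apply sum_lt_le; intros; apply indic_le1.
  - rewrite sum_lt_const; nra. }
set (M' := (M / 2)%nat).
assert (HM2 : (2 <= M)%nat) by (apply INR_le; simpl (INR 2); lra).
pose proof (Nat.div_mod_eq M 2) as Hdm; pose proof (Nat.mod_upper_bound M 2) as Hmu.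
fold M' in Hdm.
replace M with (M' + (M - M'))%nat at 1 by lia.
rewrite sum_lt_add.
assert (Hs0 : 0 < s) by lra.
assert (HM'2 : INR M' <= INR M / 2).
{ assert (INR (2 * M') <= INR M) by (apply le_INR; lia).
  rewrite mult_INR in *; simpl (INR 2) in *; lra. }
assert (HS : INR M / 2 <= INR (S M') <= INR M).
{ split; [|apply le_INR; lia].
  assert (INR M <= INR (2 * S M')) by (apply le_INR; lia).
  rewrite mult_INR in *; simpl (INR 2) in *; lra. }
assert (HM1 : 2 <= INR M) by lra.
assert (Hlow : sqrt (sqrt (INR M' / s)) <= 6 / 7 * p).
{ replace (6 / 7) with (sqrt (sqrt (((6 / 7) ^ 2) ^ 2))).
  2:{ rewrite (sqrt_pow2 ((6 / 7) ^ 2)) by nra; apply sqrt_pow2; lra. }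
  assert (0 <= INR M / s) by (apply Rmult_le_pos; [lra|left; now apply Rinv_0_lt_compat]).
  unfold p; rewrite <- sqrt_mult by apply sqrt_pos.
  rewrite <- sqrt_mult by nra.
  apply sqrt_le_1_alt, sqrt_le_1_alt.
  apply Rle_trans with (/ 2 * (INR M / s)).
  - replace (/ 2 * (INR M / s)) with (INR M / 2 * / s) by (field; lra).
    apply Rmult_le_compat_r; [left; now apply Rinv_0_lt_compat|exact HM'2].
  - apply Rmult_le_compat_r; [lra|]; lra. }
specialize (IH M' ltac:(lia) ltac:(lra)).
assert (Hhigh : sum_lt (M - M') (fun i => indic (hit (s ^ 2) Q r (S (M' + i))))
  <= s / Q * (672 * p)).
(* The terms are indexed by [S h], so the upper half starts at [S M'], and it has at most [S M']
   terms. *)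
{ set (t := sqrt (sqrt (sqrt (s / INR (S M'))))).
  assert (HsM : 1 <= s / INR (S M')).
  { apply Rmult_le_reg_r with (INR (S M')); [lra|].
    unfold Rdiv; rewrite Rmult_assoc, Rinv_l; lra. }
  assert (Ht : 1 <= t).
  { unfold t; rewrite <- sqrt_1; apply sqrt_le_1_alt.
    rewrite <- sqrt_1; apply sqrt_le_1_alt.
    rewrite <- sqrt_1; apply sqrt_le_1_alt; exact HsM. }
  assert (Ht2 : t ^ 2 = sqrt (sqrt (s / INR (S M')))) by (apply pow2_sqrt, sqrt_pos).
  assert (Ht8 : t ^ 8 = s / INR (S M')).
  { replace (t ^ 8) with (((t ^ 2) ^ 2) ^ 2) by ring.
    rewrite Ht2, pow2_sqrt by apply sqrt_pos; apply pow2_sqrt; lra. }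
  apply Rle_trans with (sum_lt (S M') (fun h => indic (hit (s ^ 2) Q r (S M' + h)))).
  { apply sum_lt_mono; [lia|intros; apply indic_ge0]. }
  apply Rle_trans with (672 * (s / (Q * t ^ 2))).
  { apply count_dyadic_decay; try assumption.
    - rewrite Ht8; field; lra.
    - rewrite Ht8; apply Rmult_le_reg_r with (INR (S M')); [lra|].
      unfold Rdiv; rewrite Rmult_assoc, Rinv_l by lra.
      assert (s < INR M * Q).
      { apply Rmult_lt_compat_r with (r := Q) in Hlt; [|lra].
        unfold Rdiv in Hlt; rewrite Rmult_assoc, Rinv_l in Hlt; lra. }
      nra. }
  replace (672 * (s / (Q * t ^ 2))) with (s / Q * (672 * / t ^ 2)) by (field; lra).
  apply Rmult_le_compat_l; [lra|]; apply Rmult_le_compat_l; [lra|].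
  rewrite Ht2, <- !sqrt_inv, Rinv_div.
  unfold p; apply sqrt_le_1_alt, sqrt_le_1_alt.
  apply Rmult_le_compat_r; [left; now apply Rinv_0_lt_compat|lra]. }
apply Rle_trans with (1 := Rplus_le_compat _ _ _ _ IH Hhigh).
rewrite <- Rmult_plus_distr_l; apply Rmult_le_compat_l; lra.
Qed.

Lemma count_hits (s Q r : R) (M : nat) :
  1 <= Q -> (22 * Q) ^ 3 <= s -> INR M <= s ->
  sum_lt M (fun h => indic (hit (s ^ 2) Q r (S h))) <= 4705 * (s / Q).
Proof.
intros HQ Hs HM.
apply Rle_trans with (1 := count_hits_decay s Q r M HQ Hs HM).
assert (Hs0 : 0 < s).
{ apply Rlt_le_trans with (2 := Hs); apply pow_lt; lra. }
assert (0 < s / Q) by (apply Rmult_lt_0_compat; [lra|apply Rinv_0_lt_compat; lra]).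
assert (sqrt (sqrt (INR M / s)) <= 1); [|nra].
rewrite <- sqrt_1; apply sqrt_le_1_alt; rewrite <- sqrt_1; apply sqrt_le_1_alt.
apply Rmult_le_reg_r with s; [exact Hs0|].
unfold Rdiv; rewrite Rmult_assoc, Rinv_l; lra.
Qed.

(** * Jumps of the floor function *)

Definition floor_div (x : R) (n : nat) : nat := Z.to_nat (Int_part (x / INR n)).

Lemma floor_div_spec (x : R) (n : nat) : 0 < x -> (1 <= n)%nat ->
  INR (floor_div x n) <= x / INR n < INR (floor_div x n) + 1 /\
  frac_part (x / INR n) = x / INR n - INR (floor_div x n).
Proof.
intros Hx Hn.
assert (Hn1 : 1 <= INR n) by (apply (le_INR 1); exact Hn).
assert (H0 : 0 < x / INR n) by (apply Rmult_lt_0_compat; [lra|apply Rinv_0_lt_compat; lra]).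
destruct (base_Int_part (x / INR n)) as [H1 H2].
assert (Hz : (0 <= Int_part (x / INR n))%Z).
{ assert (-1 < Int_part (x / INR n))%Z; [|lia]. apply lt_IZR; lra. }
unfold floor_div; rewrite INR_IZR_INZ, Z2Nat.id by exact Hz.
split; [lra|reflexivity].
Qed.

Lemma floor_div_unique (x : R) (m n : nat) : 0 < x -> (1 <= m)%nat ->
  INR n <= x / INR m < INR n + 1 -> floor_div x m = n.
Proof.
intros Hx Hm Hn; destruct (floor_div_spec x m Hx Hm) as [H _].
assert (floor_div x m < S n)%nat by (apply INR_lt; rewrite S_INR; lra).
assert (n < S (floor_div x m))%nat by (apply INR_lt; rewrite S_INR; lra).
lia.
Qed.

Lemma floor_div_decr (x : R) (n : nat) : 0 < x -> (1 <= n)%nat ->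
  (floor_div x (S n) <= floor_div x n)%nat.
Proof.
intros Hx Hn.
destruct (floor_div_spec x n Hx Hn) as [H1 _].
destruct (floor_div_spec x (S n) Hx ltac:(lia)) as [H2 _].
assert (Hn1 : 1 <= INR n) by (apply (le_INR 1); exact Hn).
assert (x / INR (S n) <= x / INR n).
{ apply Rmult_le_compat_l; [lra|]; apply Rinv_le_contravar; [lra|].
  apply le_INR; lia. }
assert (floor_div x (S n) < S (floor_div x n))%nat by (apply INR_lt; rewrite S_INR; lra).
lia.
Qed.

(** Symmetry of the hyperbola: both conditions say [m n <= x < m (n + 1)]. *)
Lemma floor_div_between (x : R) (m n : nat) : 0 < x -> (1 <= n)%nat ->
  (floor_div x (S n) < m <= floor_div x n)%nat -> floor_div x m = n.
Proof.
intros Hx Hn [H1 H2].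
destruct (floor_div_spec x n Hx Hn) as [[H3 _] _].
destruct (floor_div_spec x (S n) Hx ltac:(lia)) as [[_ H4] _].
assert (Hn1 : 1 <= INR n) by (apply (le_INR 1); exact Hn).
assert (Hm1 : 1 <= INR m) by (apply (le_INR 1); lia).
apply le_INR in H1, H2; rewrite S_INR in H1, H4.
assert (H5 : INR m * INR n <= x).
{ replace x with (x / INR n * INR n) by (field; lra).
  apply Rmult_le_compat_r; lra. }
assert (H6 : x < INR m * (INR n + 1)).
{ replace x with (x / (INR n + 1) * (INR n + 1)) by (field; lra).
  apply Rmult_lt_compat_r; lra. }
apply floor_div_unique; [exact Hx|apply INR_le; simpl (INR 1); lra|].
split; [apply Rmult_le_reg_r with (INR m)|apply Rmult_lt_reg_r with (INR m)]; try lra;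
  replace (x / INR m * INR m) with x by (field; lra); lra.
Qed.

(** The jump of [floor (x / n)] between [n] and [n + 1] counts the [m] with [floor (x / m) = n], so
    weighted jumps become a sum over [m]. The second sum on the left holds the [m] not yet reached
    after [N] steps. *)
Lemma sum_floor_div_jumps (x : R) (c : nat -> R) (n0 N : nat) :
  0 < x ->
  sum_lt N (fun i => c (S (n0 + i)) *
      (INR (floor_div x (S (n0 + i))) - INR (floor_div x (S (S (n0 + i))))))
    + sum_lt (floor_div x (S (n0 + N))) (fun h => c (floor_div x (S h)))
  = sum_lt (floor_div x (S n0)) (fun h => c (floor_div x (S h))).
Proof.
intros Hx; induction N as [|N IH]; [simpl; rewrite Nat.add_0_r; ring|].
rewrite <- IH; cbn [sum_lt]; rewrite Rplus_assoc; f_equal.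
rewrite Nat.add_succ_r; set (n := S (n0 + N)).
assert (Hd : (floor_div x (S n) <= floor_div x n)%nat) by (apply floor_div_decr; [exact Hx|lia]).
set (a := floor_div x (S n)) in *; set (b := floor_div x n) in *.
replace b with (a + (b - a))%nat at 2 by lia.
rewrite sum_lt_add.
rewrite (sum_lt_ext (b - a) _ (fun _ => c n)).
- rewrite sum_lt_const, minus_INR by exact Hd; ring.
- intros i Hi; f_equal; apply floor_div_between; [exact Hx|lia|fold a b; lia].
Qed.

(** * Periodic weights against the variation of the fractional part *)

Section PeriodicWeights.

Variables (q : nat) (c : nat -> R).
Hypothesis q_pos : (1 <= q)%nat.
Hypothesis c_ge0 : forall n, 0 <= c n.
Hypothesis c_per : forall n, c (n + q)%nat = c n.

Let S1 := sum_lt q (fun h => c (S h)).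

Lemma periodic_shift n k : c (k * q + n)%nat = c n.
Proof.
induction k as [|k IH]; [reflexivity|].
rewrite <- IH, <- (c_per (k * q + n)); f_equal; simpl; lia.
Qed.

Lemma period_sum_ge0 : 0 <= S1.
Proof. apply sum_lt_ge0; intros; apply c_ge0. Qed.

Lemma periodic_le_period_sum n : c n <= S1.
Proof.
rewrite <- c_per.
(* Residues are represented by [1, ..., q], as in [S1]; the shift by [q] keeps the natural
   subtraction exact at [n = 0]. *)
replace (n + q)%nat with ((n + q - 1) / q * q + S ((n + q - 1) mod q))%nat
  by (pose proof (Nat.div_mod_eq (n + q - 1) q); lia).
rewrite periodic_shift.
apply (sum_lt_term q (fun h => c (S h))); [|intros; apply c_ge0].
apply Nat.mod_upper_bound; lia.
Qed.

(** Sorting the floor values by residue modulo [q] gives each weight of a period at most the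
    multiplicity bounded by [count_hits]. *)
Lemma sum_weights_floor_div (s : R) (M : nat) :
  (22 * INR q) ^ 3 <= s -> INR M <= s ->
  sum_lt M (fun h => c (floor_div (s ^ 2) (S h))) <= 4705 * (S1 * (s / INR q)).
Proof.
intros Hs HM.
assert (Hq : 1 <= INR q) by (apply (le_INR 1); exact q_pos).
assert (Hs0 : 0 < s) by (apply Rlt_le_trans with (2 := Hs), pow_lt; lra).
assert (Hx : 0 < s ^ 2) by now apply pow_lt.
apply Rle_trans with (sum_lt M (fun h => sum_lt q (fun r =>
  c (S r) * indic (hit (s ^ 2) (INR q) (INR (S r)) (S h))))).
- apply sum_lt_le; intros h _.
  set (n := floor_div (s ^ 2) (S h)).
  set (r := ((n + q - 1) mod q)%nat); set (k := ((n + q - 1) / q)%nat).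
  assert (Hr : (r < q)%nat) by (apply Nat.mod_upper_bound; lia).
  assert (Hk : (n + q = k * q + S r)%nat)
    by (pose proof (Nat.div_mod_eq (n + q - 1) q); unfold k, r; lia).
  apply Rle_trans with (c (S r) * indic (hit (s ^ 2) (INR q) (INR (S r)) (S h))).
  + rewrite indic_true.
    * rewrite <- c_per, Hk, periodic_shift; lra.
    (* The 1 undoes the shift by [q]; the witness is [-1] when [n = 0]. *)
    * exists (Z.of_nat k - 1)%Z.
      destruct (floor_div_spec (s ^ 2) (S h) Hx ltac:(lia)) as [Hn _]; fold n in Hn.
      apply (f_equal INR) in Hk; rewrite !plus_INR, mult_INR in Hk.
      rewrite minus_IZR, <- INR_IZR_INZ; lra.
  + apply (sum_lt_term q (fun r => c (S r) * indic (hit (s ^ 2) (INR q) (INR (S r)) (S h))));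
      [exact Hr|intros; apply Rmult_le_pos; [apply c_ge0|apply indic_ge0]].
- rewrite sum_lt_swap.
  replace (4705 * (S1 * (s / INR q)))
    with (sum_lt q (fun r => (4705 * (s / INR q)) * c (S r)))
    by (rewrite sum_lt_scal; unfold S1; ring).
  apply sum_lt_le; intros r _; rewrite sum_lt_scal, (Rmult_comm _ (c (S r))).
  apply Rmult_le_compat_l; [apply c_ge0|now apply count_hits].
Qed.

Lemma sum_blocks (w : nat -> R) (L : nat) (n0 : nat) :
  (forall l, 0 <= w l) ->
  sum_lt (L * q) (fun i => c (S (n0 * q + i)) * w (i / q)%nat) = S1 * sum_lt L w.
Proof.
intros Hw; rewrite sum_lt_mul, <- sum_lt_scal.
apply sum_lt_ext; intros l _.
unfold S1; rewrite Rmult_comm, <- sum_lt_scal.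
apply sum_lt_ext; intros h Hh.
replace (S (n0 * q + (l * q + h))) with ((n0 + l) * q + S h)%nat by lia.
rewrite periodic_shift, Nat.div_add_l, Nat.div_small by lia.
rewrite Nat.add_0_r; ring.
Qed.

(** Telescoping, as [y (y + 1) / 2 <= y ^ 2] for [y >= 1]. *)
Lemma sum_inv_sqr_tail (Q L : nat) : (1 <= Q)%nat ->
  sum_lt L (fun l => / INR (Q + l) ^ 2) <= 2 / INR Q - 2 / INR (Q + L).
Proof.
intros HQ; induction L as [|L IH]; cbn [sum_lt]; [rewrite Nat.add_0_r; lra|].
rewrite Nat.add_succ_r, S_INR; set (y := INR (Q + L)) in *.
assert (Hy : 1 <= y) by (apply (le_INR 1); lia).
assert (/ y ^ 2 <= 2 / y - 2 / (y + 1)); [|lra].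
replace (2 / y - 2 / (y + 1)) with (/ (y * (y + 1) / 2)) by (field; lra).
apply Rinv_le_contravar; nra.
Qed.

(** The range is cut at [Q q], of order [s]. The constant is [2 + 2 + 4705]: the trivial bound below
    the cut, then the smooth part [x / (n (n + 1))] and the floor jumps above it. *)
Lemma weighted_variation_frac (s : R) (N : nat) :
  (22 * INR q) ^ 3 <= s ->
  sum_lt N (fun n => c (S n) *
      Rabs (frac_part (s ^ 2 / INR (S n)) - frac_part (s ^ 2 / INR (S (S n)))))
    <= 4709 * (S1 * (s / INR q)).
Proof.
intros Hs.
assert (Hq : 1 <= INR q) by (apply (le_INR 1); exact q_pos).
assert (Hs0 : 0 < s) by (apply Rlt_le_trans with (2 := Hs), pow_lt; lra).
assert (Hx : 0 < s ^ 2) by now apply pow_lt.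
assert (HS := period_sum_ge0).
assert (Hqs : INR q <= s).
{ replace ((22 * INR q) ^ 3) with (10648 * (INR q * INR q * INR q)) in Hs by ring. nra. }
assert (Hsq : 1 <= s / INR q).
{ apply Rmult_le_reg_r with (INR q); [lra|].
  replace (s / INR q * INR q) with s by (field; lra); lra. }
destruct (nfloor_ex (s / INR q)) as [Q' [HQ1 HQ2]]; [lra|].
set (Q := S Q').
assert (HQ : s / INR q <= INR Q <= 2 * (s / INR q)) by (unfold Q; rewrite S_INR; lra).
assert (HQs : s <= INR Q * INR q).
{ replace s with (s / INR q * INR q) by (field; lra). apply Rmult_le_compat_r; lra. }
set (v n := Rabs (frac_part (s ^ 2 / INR (S n)) - frac_part (s ^ 2 / INR (S (S n))))).
assert (Hv0 : forall n, 0 <= v n) by (intros; apply Rabs_pos).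
apply Rle_trans with (sum_lt (Q * q + N * q) (fun n => c (S n) * v n)).
{ apply sum_lt_mono; [nia|]; intros; apply Rmult_le_pos; auto. }
rewrite sum_lt_add.
assert (H1 : sum_lt (Q * q) (fun n => c (S n) * v n) <= S1 * INR Q).
{ apply Rle_trans with (sum_lt (Q * q) (fun n => c (S (0 * q + n)) * 1)).
  - apply sum_lt_le; intros n _; apply Rmult_le_compat_l; [apply c_ge0|].
    unfold v; destruct (base_fp (s ^ 2 / INR (S n))), (base_fp (s ^ 2 / INR (S (S n)))).
    apply Rabs_le; lra.
  - rewrite (sum_blocks (fun _ => 1) Q 0) by (intros; lra).
    rewrite sum_lt_const; lra. }
assert (H2 : sum_lt (N * q) (fun i => c (S (Q * q + i)) * v (Q * q + i)%nat)
  <= s ^ 2 / INR q ^ 2 * (S1 * sum_lt N (fun l => / INR (Q + l) ^ 2))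
     + 4705 * (S1 * (s / INR q))).
{ rewrite <- (sum_blocks (fun l => / INR (Q + l) ^ 2) N Q).
  2:{ intros l; left; apply Rinv_0_lt_compat, pow_lt, (lt_INR 0); unfold Q; lia. }
  rewrite <- sum_lt_scal.
  apply Rle_trans with (sum_lt (N * q) (fun i =>
      s ^ 2 / INR q ^ 2 * (c (S (Q * q + i)) * / INR (Q + i / q) ^ 2)
    + c (S (Q * q + i)) * (INR (floor_div (s ^ 2) (S (Q * q + i)))
        - INR (floor_div (s ^ 2) (S (S (Q * q + i))))))).
  - apply sum_lt_le; intros i _; set (n := (Q * q + i)%nat).
    apply Rle_trans with (c (S n) * (s ^ 2 / INR q ^ 2 * / INR (Q + i / q) ^ 2
      + (INR (floor_div (s ^ 2) (S n)) - INR (floor_div (s ^ 2) (S (S n)))))); [|right; ring].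
    apply Rmult_le_compat_l; [apply c_ge0|].
    unfold v.
    destruct (floor_div_spec (s ^ 2) (S n) Hx ltac:(lia)) as [_ ->].
    destruct (floor_div_spec (s ^ 2) (S (S n)) Hx ltac:(lia)) as [_ ->].
    assert (Hfl : INR (floor_div (s ^ 2) (S (S n))) <= INR (floor_div (s ^ 2) (S n)))
      by (apply le_INR, floor_div_decr; [exact Hx|lia]).
    set (y := INR (S n)).
    (* Bounding [n + 1] below by the start of its period makes the majorant constant on periods, as
       [sum_blocks] requires. *)
    assert (Hy : INR q * INR (Q + i / q) <= y).
    { rewrite <- mult_INR; apply le_INR.
      pose proof (Nat.div_mod_eq i q); unfold n; nia. }
    assert (Hz : 1 <= INR (Q + i / q)) by (apply (le_INR 1); unfold Q; lia).
    set (z := INR (Q + i / q)) in *.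
    rewrite (S_INR (S n)); fold y.
    assert (Hy1 : 1 <= INR q * z) by nra.
    assert (Hd : 0 <= s ^ 2 / y - s ^ 2 / (y + 1) <= s ^ 2 / INR q ^ 2 * / z ^ 2).
    { replace (s ^ 2 / y - s ^ 2 / (y + 1)) with (s ^ 2 * / (y * (y + 1))) by (field; lra).
      replace (s ^ 2 / INR q ^ 2 * / z ^ 2) with (s ^ 2 * / (INR q * z) ^ 2) by (field; lra).
      split.
      - apply Rmult_le_pos; [lra|left; apply Rinv_0_lt_compat; nra].
      - apply Rmult_le_compat_l; [lra|]; apply Rinv_le_contravar; [apply pow_lt; lra|].
        simpl; rewrite Rmult_1_r; apply Rmult_le_compat; lra. }
    apply Rabs_le; lra.
  - rewrite sum_lt_plus; apply Rplus_le_compat_l.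
    set (n0 := (Q * q)%nat).
    pose proof (sum_floor_div_jumps (s ^ 2) c n0 (N * q) Hx) as HJ.
    apply Rle_trans with (sum_lt (floor_div (s ^ 2) (S n0)) (fun h => c (floor_div (s ^ 2) (S h)))).
    + rewrite <- HJ.
      assert (0 <= sum_lt (floor_div (s ^ 2) (S (n0 + N * q)))
        (fun h => c (floor_div (s ^ 2) (S h))))
        by (apply sum_lt_ge0; intros; apply c_ge0).
      lra.
    + apply sum_weights_floor_div; [exact Hs|].
      destruct (floor_div_spec (s ^ 2) (S n0) Hx ltac:(lia)) as [[Hf _] _].
      apply Rle_trans with (1 := Hf).
      assert (Hn0 : s <= INR (S n0)) by (rewrite S_INR; unfold n0; rewrite mult_INR; lra).
      apply Rmult_le_reg_r with (INR (S n0)); [lra|].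
      replace (s ^ 2 / INR (S n0) * INR (S n0)) with (s ^ 2) by (field; lra).
      nra. }
assert (H3 : s ^ 2 / INR q ^ 2 * (S1 * sum_lt N (fun l => / INR (Q + l) ^ 2))
             <= 2 * (S1 * (s / INR q))).
{ pose proof (sum_inv_sqr_tail Q N ltac:(unfold Q; lia)) as Ht.
  assert (0 < 2 / INR (Q + N)).
  { apply Rmult_lt_0_compat; [lra|apply Rinv_0_lt_compat, (lt_INR 0); unfold Q; lia]. }
  assert (Hb : sum_lt N (fun l => / INR (Q + l) ^ 2) <= 2 * / (s / INR q)).
  { apply Rle_trans with (2 / INR Q); [lra|].
    apply Rmult_le_compat_l; [lra|]; apply Rinv_le_contravar; lra. }
  replace (2 * (S1 * (s / INR q)))
    with (s ^ 2 / INR q ^ 2 * (S1 * (2 * / (s / INR q)))) by (field; lra).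
  apply Rmult_le_compat_l.
  - apply Rmult_le_pos; [lra|left; apply Rinv_0_lt_compat, pow_lt; lra].
  - apply Rmult_le_compat_l; lra. }
assert (H4 : S1 * INR Q <= S1 * (2 * (s / INR q))) by (apply Rmult_le_compat_l; lra).
lra.
Qed.

End PeriodicWeights.

(** * Convergence of the series *)

Lemma ex_series_bounded (a : nat -> R) (B : R) :
  (forall n, 0 <= a n) -> (forall n, sum_n a n <= B) -> ex_series a /\ Series a <= B.
Proof.
intros Ha HB.
assert (He : ex_series a).
{ apply (ex_finite_lim_seq_incr (sum_n a) B); [|exact HB].
  intros n; rewrite sum_Sn; unfold plus; simpl; specialize (Ha (S n)); lra. }
split; [exact He|].
apply (is_lim_seq_le (sum_n a) (fun _ => B) (Series a) B HB);
  [exact (Series_correct a He)|apply is_lim_seq_const].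
Qed.

Lemma sum_n_sum_lt (a : nat -> R) (n : nat) : sum_n a n = sum_lt (S n) a.
Proof.
induction n as [|n IH]; [rewrite sum_O; simpl; ring|].
rewrite sum_Sn, IH; reflexivity.
Qed.

(** Abel summation: the transformed series converges absolutely, and the boundary term vanishes in
    the limit since [G] is bounded and [phi] tends to 0. The majorant [c] is kept apart from [G] so
    that one [B] serves both the real and the imaginary part of the summatory function. *)
Lemma abel_series (G phi c : nat -> R) (A B : R) :
  G 0%nat = 0 -> (forall n, Rabs (G n) <= c n) -> (forall n, c n <= A) ->
  is_lim_seq phi 0 ->
  (forall N, sum_lt N (fun n => c (S n) * Rabs (phi (S n) - phi (S (S n)))) <= B) ->
  let a := fun n => (G (S n) - G n) * phi (S n) in
  is_series a (Series a) /\ Rabs (Series a) <= B.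
Proof.
intros G0 HGc HcA Hphi HB a.
set (b := fun n => G (S n) * (phi (S n) - phi (S (S n)))).
destruct (ex_series_bounded (fun n => Rabs (b n)) B) as [Hb1 Hb2].
{ intros; apply Rabs_pos. }
{ intros n; rewrite sum_n_sum_lt; apply Rle_trans with (2 := HB (S n)).
  apply sum_lt_le; intros i _; unfold b; rewrite Rabs_mult.
  apply Rmult_le_compat_r; [apply Rabs_pos|apply HGc]. }
assert (Hab : is_series a (Series b)).
{ change (is_lim_seq (sum_n a) (Series b)).
  apply (is_lim_seq_ext (fun n => sum_n b n + G (S n) * phi (S (S n)))).
  - induction n as [|n IH].
    + rewrite !sum_O; unfold a, b; rewrite G0; ring.
    + rewrite !sum_Sn, <- IH; unfold plus, a, b; simpl; ring.
  - replace (Series b) with (Series b + 0) by ring.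
    apply is_lim_seq_plus'.
    + exact (Series_correct b (ex_series_Rabs b Hb1)).
    + apply is_lim_seq_abs_0.
      apply is_lim_seq_le_le with (u := fun _ => 0) (w := fun n => A * Rabs (phi (S (S n)))).
      * intros n; rewrite Rabs_mult; split.
        -- apply Rmult_le_pos; apply Rabs_pos.
        -- apply Rmult_le_compat_r; [apply Rabs_pos|].
           apply Rle_trans with (1 := HGc _); apply HcA.
      * apply is_lim_seq_const.
      * replace (Finite 0) with (Rbar_mult A 0) by (simpl; f_equal; ring).
        apply is_lim_seq_scal_l.
        apply (is_lim_seq_incr_1 (fun n => Rabs (phi (S n)))).
        apply (is_lim_seq_incr_1 (fun n => Rabs (phi n))).
        apply is_lim_seq_abs_0 in Hphi; exact Hphi. }
rewrite (is_series_unique _ _ Hab); split; [exact Hab|].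
apply Rle_trans with (2 := Hb2); now apply Series_Rabs.
Qed.

(** Each component is brought within [eps / 2]; the modulus is at most [sqrt 2] times the larger
    component, and [sqrt 2 < 2]. *)
Lemma is_series_C (a : nat -> C) (l1 l2 : R) :
  is_series (fun n => Re (a n)) l1 -> is_series (fun n => Im (a n)) l2 ->
  is_series a (l1, l2).
Proof.
intros H1 H2.
assert (HRI : forall n, sum_n (fun k => Re (a k)) n = Re (sum_n a n)
                     /\ sum_n (fun k => Im (a k)) n = Im (sum_n a n)).
{ induction n as [|n [IH1 IH2]]; [rewrite !sum_O; tauto|].
  rewrite !sum_Sn, IH1, IH2; split; reflexivity. }
apply filterlim_locally_ball_norm; intros eps.
assert (He : 0 < eps / 2) by (destruct eps; simpl; lra).
generalize (proj1 (filterlim_locally_ball_norm _ _) H1 (mkposreal _ He)).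
generalize (proj1 (filterlim_locally_ball_norm _ _) H2 (mkposreal _ He)).
intros [N2 HN2] [N1 HN1]; exists (max N1 N2); intros n Hn.
destruct (HRI n) as [E1 E2].
assert (D1 : Rabs (Re (sum_n a n) - l1) < eps / 2)
  by (rewrite <- E1; exact (HN1 n ltac:(lia))).
assert (D2 : Rabs (Im (sum_n a n) - l2) < eps / 2)
  by (rewrite <- E2; exact (HN2 n ltac:(lia))).
change (Cmod (sum_n a n - (l1, l2))%C < eps).
apply Rle_lt_trans with (1 := Cmod_2Rmax _); simpl.
assert (Hs : sqrt 2 < 2).
{ rewrite <- (sqrt_pow2 2) at 2 by lra; apply sqrt_lt_1; lra. }
assert (Hs0 : 0 < sqrt 2) by (apply sqrt_lt_R0; lra).
assert (Hm : forall p r e, Rabs p < e -> Rabs r < e -> 0 <= Rmax (Rabs p) (Rabs r) < e).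
{ intros p r e Hp Hr; split; [apply Rle_trans with (2 := Rmax_l _ _); apply Rabs_pos|].
  now apply Rmax_lub_lt. }
specialize (Hm _ _ _ D1 D2).
unfold Re, Im, Rminus in Hm; destruct eps as [e Hep]; simpl in *; nra.
Qed.

Lemma frac_part_div_lim (x : R) : 0 < x ->
  is_lim_seq (fun n => frac_part (x / INR n)) 0.
Proof.
intros Hx.
apply is_lim_seq_incr_1.
apply is_lim_seq_le_le with (u := fun _ => 0) (w := fun n => x * / INR (S n)).
- intros n; destruct (floor_div_spec x (S n) Hx ltac:(lia)) as [_ E].
  destruct (base_fp (x / INR (S n))) as [H _].
  pose proof (pos_INR (floor_div x (S n))); unfold Rdiv in *; lra.
- apply is_lim_seq_const.
- replace (Finite 0) with (Rbar_mult x 0) by (simpl; f_equal; ring).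
  apply is_lim_seq_scal_l.
  apply (is_lim_seq_incr_1 (fun n => / INR n)).
  apply (is_lim_seq_inv INR p_infty); [apply is_lim_seq_INR|discriminate].
Qed.

(** * The summatory function and the final estimate *)

Lemma sum_n_m_sum_lt (g : nat -> R) (n : nat) :
  sum_n_m g 1 n = sum_lt n (fun h => g (S h)).
Proof.
induction n as [|n IH]; [now rewrite sum_n_m_zero by lia|].
rewrite sum_n_Sm by lia; rewrite IH; reflexivity.
Qed.

Lemma summatory_S (f : nat -> C) (n : nat) :
  summatory f (S n) = (summatory f n + f (S n))%C.
Proof. unfold summatory; rewrite sum_n_Sm by lia; reflexivity. Qed.

Lemma summatory_0 (f : nat -> C) : summatory f 0 = RtoC 0.
Proof. unfold summatory; rewrite sum_n_m_zero by lia; reflexivity. Qed.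

Lemma summatory_periodic (q : nat) (f : nat -> C) (n : nat) :
  periodic q f -> summatory f q = RtoC 0 ->
  summatory f (n + q) = summatory f n.
Proof.
intros Hf Hq; induction n as [|n IH].
- simpl; now rewrite Hq, summatory_0.
- change (S n + q)%nat with (S (n + q)); rewrite !summatory_S, IH.
  f_equal; exact (Hf (S n) ltac:(lia)).
Qed.

Lemma Cmod_le_Re_Im (z : C) : Cmod z <= Rabs (Re z) + Rabs (Im z).
Proof.
unfold Cmod; rewrite <- (sqrt_pow2 (Rabs (Re z) + Rabs (Im z)))
  by (pose proof (Rabs_pos (Re z)); pose proof (Rabs_pos (Im z)); lra).
apply sqrt_le_1_alt.
pose proof (Rabs_pos (Re z)); pose proof (Rabs_pos (Im z)).
rewrite <- (pow2_abs (fst z)), <- (pow2_abs (snd z)); unfold Re, Im in *; nra.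
Qed.

Lemma im_le_Cmod (z : C) : Rabs (Im z) <= Cmod z.
Proof. apply Rle_trans with (2 := Rmax_Cmod z); apply Rmax_r. Qed.

Lemma modulus_le_sqrt (q x : R) :
  0 < q -> 0 < x -> q <= Rpower x (1 / 6) / 22 -> (22 * q) ^ 3 <= sqrt x.
Proof.
intros Hq Hx H.
replace (sqrt x) with (Rpower x (1 / 6) ^ 3).
- apply pow_incr; lra.
- rewrite <- Rpower_sqrt by exact Hx.
  rewrite <- Rpower_pow by apply exp_pos.
  rewrite Rpower_mult; f_equal; simpl; field.
Qed.

Theorem mainTheorem3 :
  exists K : R,
    forall (q : nat) (f : nat -> C) (x : R),
      (1 <= q)%nat ->
      periodic q f ->
      sum_n_m f 1 q = RtoC 0 ->
      0 < x ->
      INR q <= Rpower x (1 / 6) / 22 ->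
      is_series (Delta_sum_term f x) (Delta_sum f x) /\
      Cmod (Delta_sum f x)
        <= K * (sum_n_m (fun k : nat => Cmod (summatory f k)) 1 q / INR q * sqrt x).
Proof.
(* [9418 = 2 * 4709]: the real and imaginary parts are bounded separately. *)
exists 9418; intros q f x Hq Hper Hmean Hx Hqx.
assert (Hq1 : 1 <= INR q) by (apply (le_INR 1); exact Hq).
assert (Hs := modulus_le_sqrt (INR q) x ltac:(lra) Hx Hqx).
set (s := sqrt x) in *.
assert (Hxs : x = s ^ 2) by (symmetry; apply pow2_sqrt; lra).
set (c := fun n => Cmod (summatory f n)).
assert (Hc0 : forall n, 0 <= c n) by (intros; apply Cmod_ge_0).
assert (Hcper : forall n, c (n + q)%nat = c n).
{ intros n; unfold c; f_equal; now apply summatory_periodic. }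
rewrite sum_n_m_sum_lt.
change (fun h : nat => Cmod (summatory f (S h))) with (fun h : nat => c (S h)).
set (S1 := sum_lt q (fun h => c (S h))).
set (phi := fun n => frac_part (x / INR n)).
assert (HB : forall N, sum_lt N (fun n => c (S n) * Rabs (phi (S n) - phi (S (S n))))
  <= 4709 * (S1 * (s / INR q))).
{ intros N; unfold phi; rewrite Hxs; now apply weighted_variation_frac. }
assert (HA : forall n, c n <= S1) by (intros; now apply periodic_le_period_sum).
assert (Hphi : is_lim_seq phi 0) by now apply frac_part_div_lim.
assert (HRe : forall n, Re (Delta_sum_term f x n)
  = (Re (summatory f (S n)) - Re (summatory f n)) * phi (S n)).
{ intros n; rewrite summatory_S; unfold Delta_sum_term; fold (phi (S n)).
  generalize (phi (S n)), (f (S n)), (summatory f n); intros p [u1 u2] [v1 v2].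
  simpl; ring. }
assert (HIm : forall n, Im (Delta_sum_term f x n)
  = (Im (summatory f (S n)) - Im (summatory f n)) * phi (S n)).
{ intros n; rewrite summatory_S; unfold Delta_sum_term; fold (phi (S n)).
  generalize (phi (S n)), (f (S n)), (summatory f n); intros p [u1 u2] [v1 v2].
  simpl; ring. }
destruct (abel_series (fun n => Re (summatory f n)) phi c S1 _
  ltac:(cbv beta; now rewrite summatory_0) ltac:(intros; apply re_le_Cmod) HA Hphi HB) as [R1 R2].
destruct (abel_series (fun n => Im (summatory f n)) phi c S1 _
  ltac:(cbv beta; now rewrite summatory_0) ltac:(intros; apply im_le_Cmod) HA Hphi HB) as [I1 I2].
rewrite <- (Series_ext _ _ HRe) in R1, R2.
rewrite <- (Series_ext _ _ HIm) in I1, I2.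
split.
- apply is_series_C.
  + apply is_series_ext with (2 := R1); intros n; now rewrite HRe.
  + apply is_series_ext with (2 := I1); intros n; now rewrite HIm.
- apply Rle_trans with (1 := Cmod_le_Re_Im _).
  apply Rle_trans with (1 := Rplus_le_compat _ _ _ _ R2 I2).
  right; field; lra.
Qed.
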